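(* Let $(E_n)_{n\in\mathbb N}$ be a betting sequence on the filtered space described in the context, let $n\in\mathbb N$ and $s\in(0,\infty)$, and set $\beta:=\frac1{1+s}\in(0,1)$. Then $$\mathbb E_{\mathbb P_1}\big[E_n^{-s}\mid\mathcal F_{n-1}\big]\ \ge\ e^{-\lambda_n(\beta)}\qquad\mathbb P_1\text{-a.s.}$$
   Context: Setting: $(\Omega,\mathcal F)$ is a measurable space with a filtration $(\mathcal F_t)_{t\in\mathbb N_0}$, $\mathcal F_0=\{\emptyset,\Omega\}$, and $\mathbb P_0,\mathbb P_1$ are probability measures on $(\Omega,\mathcal F)$. Standing assumption: for every $t\in\mathbb N=\{1,2,\dots\}$, $\mathbb P_1\ll\mathbb P_0$ on $\mathcal F_t$ and $\mathrm{KL}(\mathbb P_1|_{\mathcal F_t}\|\mathbb P_0|_{\mathcal F_t})<\infty$. Let $L_t:=\frac{d\mathbb P_1|_{\mathcal F_t}}{d\mathbb P_0|_{\mathcal F_t}}$, $L_0=1$, and let the one-step ratio be $R_t:=L_t/L_{t-1}$ on $\{L_{t-1}>0\}$ and $R_t:=1$ elsewhere. For $\beta\in(0,1]$ define $Z_{\beta,t}:=\mathbb E_{\mathbb P_0}[R_t^\beta\mid\mathcal F_{t-1}]$ and $\lambda_t(\beta):=-\frac1\beta\log Z_{\beta,t}$. A betting sequence is a sequence $(E_t)_{t\in\mathbb N}$ where each $E_t:\Omega\to[0,\infty]$ is $\mathcal F_t$-measurable with $\mathbb E_{\mathbb P_0}[E_t\mid\mathcal F_{t-1}]\le1$ $\mathbb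 P_0$-a.s. Conventions: for $s>0$, $0^{-s}=+\infty$, $(+\infty)^{-s}=0$; $0\cdot\infty=0$. *)

(* Defs.v *)
From HB Require Import structures.
From mathcomp Require Import all_boot all_order all_algebra.
From mathcomp Require Import all_classical all_reals all_analysis.
From mathcomp Require Import measurable_realfun.

Set Implicit Arguments.
Unset Strict Implicit.
Unset Printing Implicit Defensive.

Import Order.TTheory GRing.Theory Num.Theory.
Import numFieldNormedType.Exports.

Local Open Scope classical_set_scope.
Local Open Scope ring_scope.
Local Open Scope ereal_scope.

Record sub_sigma_algebra d (T : measurableType d) := SubSigmaAlgebra {
  sub_sets :> set (set T) ;
  sub_sets_sigma_algebra : sigma_algebra setT sub_sets ;
  sub_sets_measurable : sub_sets `<=` measurable }.

(* [T] seen as the measurable space (T, G); [measurable] is then [<<s G >>],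
   which equals [G] by [sub_measurableE]. *)
Notation subT G := (g_sigma_algebraType (sub_sets G)).

Record filtration d (T : measurableType d) := Filtration {
  filt :> nat -> sub_sigma_algebra T ;
  filt_nondecreasing : forall i j, (i <= j)%N -> filt i `<=` filt j ;
  filt_0 : sub_sets (filt 0%N) = [set set0; setT] }.

Section sub_sigma_algebra_theory.
Context d (T : measurableType d) (R : realType).
Variable G : sub_sigma_algebra T.

Lemma sub_measurableE : (measurable : set (set (subT G))) = sub_sets G.
Proof. exact/measurable_g_measurableTypeE/sub_sets_sigma_algebra. Qed.

Lemma sub_measurableW (A : set T) :
  measurable (A : set (subT G)) -> measurable A.
Proof. by rewrite sub_measurableE; exact: sub_sets_measurable. Qed.

Definition to_sub (w : T) : subT G := w.

Lemma measurable_to_sub : measurable_fun setT to_sub.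
Proof. by move=> _ A mA; rewrite setTI; exact: sub_measurableW mA. Qed.

HB.instance Definition _ :=
  isMeasurableFun.Build _ _ _ _ to_sub measurable_to_sub.

Lemma sub_measurable_fun d' (U : measurableType d') (f : T -> U) :
  measurable_fun [set: subT G] (f : T -> U) -> measurable_fun setT f.
Proof. by move=> mf; exact: (measurableT_comp mf measurable_to_sub). Qed.

(* The restriction of [P] to [G], as the image of [P] under the identity
   from T to (T, G). *)
Definition restr (P : probability T R) : probability (subT G) R :=
  distribution P (to_sub : {mfun T >-> subT G}).

Lemma integral_restr (P : probability T R) (f : T -> \bar R) (A : set T) :
  measurable_fun [set: subT G] (f : T -> \bar R) -> (forall w, 0 <= f w) ->
  measurable (A : set (subT G)) ->
  \int[restr P]_(w in A) f w = \int[P]_(w in A) f w.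
Proof.
move=> mf f0 mA.
rewrite [LHS](@ge0_integral_pushforward _ _ _ _ R to_sub measurable_to_sub)//.
exact: measurable_funS mf.
Qed.

End sub_sigma_algebra_theory.

Section conditional_expectation.
Context d (T : measurableType d) (R : realType).
Variables (P : probability T R) (G : sub_sigma_algebra T).

Definition is_condexp (X Y : T -> \bar R) :=
  [/\ measurable_fun [set: subT G] (Y : T -> \bar R),
      forall w, 0 <= Y w
    & forall A, sub_sets G A -> \int[P]_(w in A) Y w = \int[P]_(w in A) X w].

(* A version of E[X | G], for X with values in [0, +oo]; meaningful by
   [condexpP], and unique up to a P-null set. *)
Definition condexp (X : T -> \bar R) : T -> \bar R :=
  xget (cst 0) [set Y | is_condexp X Y].

Section bounded.
Variables (X : T -> \bar R).
Hypotheses (mX : measurable_fun setT X) (X0 : forall w, 0 <= X w)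
  (X1 : forall w, X w <= 1).

Let nu (A : set (subT G)) : \bar R := \int[P]_(w in A) X w.

Let nu0 : nu set0 = 0. Proof. exact: integral_set0. Qed.

Let nu_ge0 A : 0 <= nu A. Proof. exact: integral_ge0. Qed.

Let nu_sigma_additive : semi_sigma_additive nu.
Proof.
move=> F mF tF mUF.
apply: (semi_sigma_additive_nng_induced mX X0) => //.
- by move=> n; exact: sub_measurableW (mF n).
- exact: sub_measurableW mUF.
Qed.

HB.instance Definition _ :=
  isMeasure.Build _ _ _ nu nu0 nu_ge0 nu_sigma_additive.

Let nu_le A : measurable A -> nu A <= P A.
Proof.
move=> mA; have mA' := sub_measurableW mA.
rewrite -[leRHS]mul1e -integral_cst//.
apply: ge0_le_integral => //.
exact: measurable_funTS.
Qed.

Let nu_fin : fin_num_fun nu.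
Proof.
move=> A mA; rewrite ge0_fin_numE//; apply: le_lt_trans (nu_le mA) _.
by apply: (le_lt_trans (probability_le1 P _)); rewrite ?ltry//;
  exact: sub_measurableW mA.
Qed.

HB.instance Definition _ := Measure_isFinite.Build _ _ _ nu nu_fin.

Lemma condexp_exists_le1 : exists Y, is_condexp X Y.
Proof.
have dom : nu `<< restr G P.
  apply/null_content_dominatesP => A mA PA0.
  by apply/eqP; rewrite eq_le nu_ge0 andbT -PA0; exact: nu_le.
pose Y : T -> \bar R := Radon_Nikodym_SigmaFinite.f nu (restr G P).
have mY : measurable_fun [set: subT G] (Y : T -> \bar R).
  exact: measurable_int (Radon_Nikodym_SigmaFinite.f_integrable dom).
have Y0 w : 0 <= Y w by exact: Radon_Nikodym_SigmaFinite.f_ge0.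
exists Y; split => // A GA.
have mA : measurable (A : set (subT G)) by rewrite sub_measurableE.
by rewrite -(integral_restr _ mY)// -Radon_Nikodym_SigmaFinite.f_integral.
Qed.

End bounded.

Lemma condexp_exists (X : T -> \bar R) :
  measurable_fun setT X -> (forall w, 0 <= X w) -> exists Y, is_condexp X Y.
Proof.
move=> mX X0.
pose c k : \bar R := (k%:R : R)%:E.
pose h k w := mine (X w) (c k.+1) - mine (X w) (c k).
have mh k : measurable_fun setT (h k).
  by apply: emeasurable_funB; apply: measurable_mine.
have m_fin w k : mine (X w) (c k) \is a fin_num.
  have m0 : 0 <= mine (X w) (c k) by rewrite le_min X0 /c lee_fin ler0n.
  by rewrite ge0_fin_numE// gt_min ltry orbT.
have h0 k w : 0 <= h k w.
  rewrite /h sube_ge0 ?m_fin ?orbT//.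
  by rewrite le_min ge_min lexx/= ge_min /c lee_fin ler_nat leqnSn orbT.
have h1 k w : h k w <= 1.
  rewrite /h leeBlDr//.
  rewrite ge_min addeC; have [Xk|kX] := leP (X w) (c k).
    by rewrite leeDl.
  by rewrite /c -EFinD natr1 lexx orbT.
have hsum w : \sum_(k <oo) h k w = X w.
  have part n : \sum_(0 <= k < n) h k w = mine (X w) (c n).
    elim: n => [|n IH]; first by rewrite big_nil; apply/esym/min_idPr/X0.
    by rewrite big_nat_recr//= IH addeC subeK//.
  apply/cvg_lim => //; rewrite (_ : (fun _ => _) = fun n => mine (X w) (c n));
    last by apply/funext => n; exact: part.
  case: (X w) (X0 w) => [r r0| _|//]; last first.
    rewrite (_ : (fun _ => _) = c); last by
      apply/funext => n; apply/min_idPr; rewrite leey.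
    by apply/cvgeryP; exact: cvgr_idn.
  apply: cvg_near_cst; near=> n; apply/min_idPl; rewrite lee_fin.
  by near: n; exact: nbhs_infty_ger.
have /choice [Y HY] k := condexp_exists_le1 (mh k) (h0 k) (h1 k).
have mY k : measurable_fun [set: subT G] (Y k : T -> \bar R) by case: (HY k).
have Y0 k w : 0 <= Y k w by case: (HY k).
exists (fun w => \sum_(k <oo) Y k w); split.
- by apply: (@ge0_emeasurable_sum _ (subT G) _ _ _ xpredT).
- by move=> w; apply: nneseries_ge0.
move=> A GA; have mA : measurable A by exact: (sub_sets_measurable GA).
rewrite integral_nneseries//; last first.
  by move=> k; exact: measurable_funTS (sub_measurable_fun (mY k)).
under [RHS]eq_integral do rewrite -hsum.
rewrite integral_nneseries//; last by move=> k; exact: measurable_funTS.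
by apply: eq_eseriesr => k _; case: (HY k) => _ _; exact.
Unshelve. all: by end_near. Qed.

Lemma condexpP (X : T -> \bar R) :
  measurable_fun setT X -> (forall w, 0 <= X w) -> is_condexp X (condexp X).
Proof. by move=> mX X0; exact: (xgetPex _ (condexp_exists mX X0)). Qed.

End conditional_expectation.

(* Among the versions of dnu/dmu this one takes its values in [0, +oo[
   everywhere, which 'd nu '/d mu does not guarantee on null sets. *)
Notation density := Radon_Nikodym_SigmaFinite.f.

Definition KL d (T : measurableType d) (R : realType)
    (nu mu : probability T R) : \bar R :=
  if `[< nu `<< mu >] then \int[nu]_w lne (density nu mu w) else +oo.

Section likelihood_ratio.
Context d (T : measurableType d) (R : realType).
Variables (P0 P1 : probability T R) (F : filtration T).

Definition L (t : nat) : T -> \bar R :=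
  if t is 0%N then cst 1 else density (restr (F t) P1) (restr (F t) P0).

Definition ratio (t : nat) (w : T) : \bar R :=
  if 0 < L t.-1 w then L t w / L t.-1 w else 1.

Definition Z (beta : R) (t : nat) : T -> \bar R :=
  condexp P0 (F t.-1) (fun w => ratio t w `^ beta).

(* [lne 0 = -oo], so that [lambda] is [+oo] where [Z] vanishes. *)
Definition lambda (t : nat) (beta : R) (w : T) : \bar R :=
  - ((beta^-1)%:E * lne (Z beta t w)).

End likelihood_ratio.

Definition betting_sequence d (T : measurableType d) (R : realType)
    (P0 : probability T R) (F : filtration T) (E : nat -> T -> \bar R) :=
  forall t, (0 < t)%N ->
    [/\ measurable_fun [set: subT (F t)] (E t : T -> \bar R),
        forall w, 0 <= E t w
      & {ae P0, forall w, condexp P0 (F t.-1) (E t) w <= 1}].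

(* x^(-s) on [0, +oo] with 0^(-s) = +oo and (+oo)^(-s) = 0, for s > 0; the
   library's [x `^ (- s)] instead vanishes at 0. *)
Definition neg_powere (R : realType) (x : \bar R) (s : R) : \bar R :=
  (x `^ s)^-1.

(* Main.v *)
Require Import Defs.
From HB Require Import structures.
From mathcomp Require Import all_boot all_order all_algebra.
From mathcomp Require Import all_classical all_reals all_analysis.
From mathcomp Require Import measurable_realfun ring lra.

(* With Z = E0[R^b | G] and Y = E1[E^-s | G], where G = F_(n-1) and b = 1/(1+s),
   a conditional Hoelder inequality is wanted: Z <= Y^b almost surely under P1.
   It is obtained from Young's inequality with a constant weight q > 0,
     L_(n-1) R^b <= b q^(b-1) L_n E^-s + (1-b) q^b L_(n-1) E,
   integrated under P0 over a set A of G: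
     int_A Z dP1 <= b q^(b-1) int_A Y dP1 + (1-b) q^b P1(A).
   On A = {Y < q, r^b < Z} with q < r this reads r^b P1(A) <= q^b P1(A), so A is
   null; rational pairs (q, r) exhaust the event {Y < Z^(1/b)}. *)

Set Implicit Arguments.
Unset Strict Implicit.
Unset Printing Implicit Defensive.

Import Order.TTheory GRing.Theory Num.Theory.
Import numFieldNormedType.Exports.

Local Open Scope classical_set_scope.
Local Open Scope ring_scope.
Local Open Scope ereal_scope.

(** * Measurability of the extended inverse *)

Lemma measurable_inve (R : realType) :
  measurable_fun [set: \bar R] (fun x : \bar R => x^-1).
Proof.
(* A real power is faithful only on nonnegative bases, so [1/x] is written as [x] times the power -1
   of [x^2], which keeps the sign. At [+oo], [fine] gives 0, the correct inverse. *)
have -> : (fun x : \bar R => x^-1) = (fun x => if x == 0 then +oo else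
    if x == -oo then -oo else (fine x * (fine x ^+ 2) `^ (-1))%:E).
  apply/funext => x; case: inveP => //=; rewrite ?eqxx//.
    by rewrite mul0r.
  move=> r r0; rewrite eqe (negbTE r0) powR_inv1 ?sqr_ge0//.
  by rewrite expr2 invfM mulrA mulfV ?mul1r.
apply: measurable_fun_ifT => //=; first exact: measurable_fun_eqe.
apply: measurable_fun_ifT => //=; first exact: measurable_fun_eqe.
apply/measurable_EFinP; apply: measurable_funM => //=.
apply: (@measurableT_comp _ _ _ _ _ _ (@powR R ^~ (-1)%R)) => //.
exact: measurable_funX.
Qed.

(** * Integrals with a weight measurable for the sub-sigma-algebra *)

Section weight.
Import HBNNSimple.
Context d (T : measurableType d) (R : realType) (G : Defs.sub_sigma_algebra T).
Implicit Types (mu : {measure set T -> \bar R}) (X f : T -> \bar R).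

(** The level sets of [h] belong to [G], so each term on the right involves [X] only through
    integrals over sets of [G] when [A] does too. *)
Lemma integral_nnsfun_weight mu X (A : set T) (h : {nnsfun subT G >-> R}) :
  measurable A -> measurable_fun setT X -> (forall w, 0 <= X w) ->
  \int[mu]_(w in A) ((h w)%:E * X w) =
  \sum_(y \in range h) (y%:E * \int[mu]_(w in A `&` h @^-1` [set y]) X w).
Proof.
move=> mA mX X0.
have mh y : measurable (h @^-1` [set y] : set T).
  by apply: (@sub_measurableW _ _ G); exact: measurable_sfunP.
transitivity (\int[mu]_(w in A) \sum_(y \in range h)
    (y * \1_(h @^-1` [set y]) w)%:E * X w).
  apply: eq_integral => w _; rewrite -ge0_mule_fsuml => [|y]; last first.
    exact: nnfun_muleindic_ge0.
  by rewrite fsumEFin// -(fimfunE h w).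
have myh y : measurable_fun A (fun w : T => (y * \1_(h @^-1` [set y]) w)%:E).
  by apply/measurable_EFinP; apply: measurable_funM.
rewrite ge0_integral_fsum//; last 2 first.
- by move=> y; apply: emeasurable_funM => //; exact: measurable_funTS.
- by move=> y w _; rewrite mule_ge0// nnfun_muleindic_ge0.
apply: eq_fsbigr => y /[!inE] -[w _ <-].
under eq_integral do rewrite EFinM -muleA.
rewrite ge0_integralZl ?lee_fin//; last 2 first.
- apply: emeasurable_funM; last exact: measurable_funTS.
  by apply/measurable_EFinP; exact: measurable_indic.
- by move=> t _; rewrite mule_ge0// lee_fin.
congr (_ * _); rewrite integral_mkcondr epatch_indic.
by apply: eq_integral => t _; rewrite /= muleC.
Qed.

(** Monotone convergence along simple functions approximating [f], built on [subT G] so that their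
    level sets stay in [G]. *)
Lemma integral_weight mu X f (A : set T)
    (Gf : measurable_fun [set: subT G] (f : T -> \bar R)) :
  measurable A -> measurable_fun setT X -> (forall w, 0 <= X w) ->
  (forall w, 0 <= f w) ->
  \int[mu]_(w in A) (f w * X w) =
  limn (fun n =>
    \int[mu]_(w in A) ((nnsfun_approx measurableT Gf n w)%:E * X w)).
Proof.
move=> mA mX X0 f0; set h := nnsfun_approx _ _.
have h_cvg w : (h n w)%:E @[n --> \oo] --> f w.
  by apply: (@cvg_nnsfun_approx _ (subT G)).
have h_nd w : {homo (fun n => h n w) : m n / (m <= n)%N >-> (m <= n)%R}.
  by move=> m n mn; exact/lefP/nd_nnsfun_approx.
rewrite -monotone_convergence//.
- apply: eq_integral => w _; apply/esym/cvg_lim => //.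
  (* A product [0 * oo] would defeat continuity of multiplication; when the product is 0, the
     approximants are squeezed between 0 and 0 instead. *)
  have [fX0|/neq0_mule_def fX] := eqVneq (f w * X w) 0; last first.
    exact: cvgeM fX (h_cvg w) (cvg_cst _).
  rewrite fX0; under eq_fun => n.
    rewrite (_ : (h n w)%:E * X w = 0); last first.
      apply/eqP; rewrite eq_le mule_ge0 ?lee_fin// andbT -fX0 lee_wpmul2r//.
      by rewrite nnsfun_approxE; exact: le_approx.
    over.
  exact: cvg_cst.
- move=> n; apply: emeasurable_funM; last exact: measurable_funTS.
  apply/measurable_EFinP; apply: measurable_funTS.
  exact: (@sub_measurable_fun _ _ G).
- by move=> n w _; rewrite mule_ge0// lee_fin.
- by move=> w _ m n mn; rewrite lee_wpmul2r// lee_fin h_nd.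
Qed.

(** Two measures are allowed, so that this serves both for the change of measure from [P0] to [P1]
    and for conditional expectations under a single measure. *)
Lemma eq_integral_weight (mu nu : {measure set T -> \bar R}) X Y f :
  measurable_fun setT X -> measurable_fun setT Y ->
  (forall w, 0 <= X w) -> (forall w, 0 <= Y w) ->
  measurable_fun [set: subT G] (f : T -> \bar R) -> (forall w, 0 <= f w) ->
  (forall A, sub_sets G A -> \int[mu]_(w in A) X w = \int[nu]_(w in A) Y w) ->
  forall A, sub_sets G A ->
  \int[mu]_(w in A) (f w * X w) = \int[nu]_(w in A) (f w * Y w).
Proof.
move=> mX mY X0 Y0 Gf f0 XY A GA.
have mA : measurable A by exact: sub_sets_measurable GA.
rewrite !(integral_weight _ Gf)//; congr (limn _); apply/funext => n.
rewrite !integral_nnsfun_weight//; apply: eq_fsbigr => y _; congr (_ * _).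
have mGP B : measurable (B : set (subT G)) -> sub_sets G B.
  by rewrite sub_measurableE.
apply/XY/mGP/measurableI; first by rewrite sub_measurableE.
exact: measurable_sfunP.
Qed.

End weight.

(** * Young's inequality for the one-step ratio *)

Lemma young_powR (R : realType) (s b q x e : R) :
  (0 < b < 1 -> s * b = 1 - b -> 0 < q -> 0 <= x -> 0 < e ->
  x `^ b <= b * q `^ (b - 1) * (x * (e `^ s)^-1) + (1 - b) * q `^ b * e)%R.
Proof.
move=> /andP[b0 b1] sb q0 x0 e0; rewrite -subr_gt0 in b1.
(* The conjugate exponents are [1/b] and [1/(1-b)]. In the product of the two factors the powers of
   [e] cancel because [s b = 1 - b], those of [q] because [(b-1) b + b (1-b) = 0]. *)
have := @conjugate_powR R ((q `^ (b - 1) * (x * (e `^ s)^-1)) `^ b)%R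
  ((q `^ b * e) `^ (1 - b))%R b^-1%R (1 - b)^-1%R.
rewrite !powR_ge0 !invr_gt0 b0 b1 !invrK -!powRrM !divff ?gt_eqF//.
rewrite ?powRr1 ?(mulr_ge0, invr_ge0, powR_ge0, ltW b0, ltW q0, ltW e0)//.
move=> /(_ isT isT isT isT (subrKC _ _)).
have -> : ((q `^ (b - 1) * (x * (e `^ s)^-1)) `^ b * (q `^ b * e) `^ (1 - b) =
    x `^ b)%R.
  rewrite -powRN !powRM ?(mulr_ge0, powR_ge0, ltW q0, ltW e0)// -!powRrM.
  rewrite mulNr sb mulrACA -powRD.
    rewrite (_ : ((b - 1) * b + b * (1 - b))%R = 0%R); last by ring.
    rewrite powRr0 mul1r -mulrA -powRD ?(gt_eqF e0) ?implybT//.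
    by rewrite addNr powRr0 mulr1.
  by rewrite (gt_eqF q0) implybT.
by move/le_trans; apply; rewrite (mulrC _ b) (mulrC _ (1 - b))%R !mulrA.
Qed.

Lemma neg_powere_ge0 (R : realType) (x : \bar R) (s : R) : 0 <= neg_powere x s.
Proof. by rewrite inve_ge0 poweR_ge0. Qed.

Lemma measurable_neg_powere (R : realType) (s : R) :
  measurable_fun [set: \bar R] (fun x : \bar R => neg_powere x s).
Proof.
exact: measurableT_comp (@measurable_inve R) (measurable_poweR s).
Qed.

(** For [l] and [e] positive and finite this is [young_powR] at [x = m / l], multiplied by [l]. If
    [l = 0] the left side vanishes; if [l > 0] and [e = +oo] the right side is infinite. *)
Lemma young_ratio (R : realType) (s b q : R) (l m e : \bar R) :
  (0 < b < 1)%R -> (s * b = 1 - b)%R -> (0 < q)%R ->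
  0 <= l -> l \is a fin_num -> 0 <= m -> m \is a fin_num -> 0 <= e ->
  l * (if 0 < l then m / l else 1) `^ b <=
  (b * q `^ (b - 1))%:E * (neg_powere e s * m) +
  ((1 - b) * q `^ b)%:E * (l * e).
Proof.
move=> b01 sb q0 l0 lfin m0 mfin e0; have /andP[b0 b1] := b01.
have s0 : (0 < s)%R by rewrite -(pmulr_lgt0 _ b0) sb subr_gt0.
rewrite -subr_gt0 in b1.
have c0 : (0 < b * q `^ (b - 1))%R by rewrite mulr_gt0 ?powR_gt0.
have c1 : (0 < (1 - b) * q `^ b)%R by rewrite mulr_gt0 ?powR_gt0.
have [->|lneq0] := eqVneq l 0.
  rewrite !mul0e mule0 adde0 mule_ge0 ?lee_fin ?(ltW c0)// mule_ge0//.
  exact: neg_powere_ge0.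
have lgt0 : 0 < l by rewrite lt0e lneq0.
have [->|eNy] := eqVneq e +oo.
  rewrite gt0_muley// gt0_muley ?lte_fin// addey ?leey//.
  rewrite gt_eqF// (@lt_le_trans _ _ 0)// mule_ge0 ?lee_fin ?(ltW c0)//.
  rewrite mule_ge0//.
  exact: neg_powere_ge0.
(* Here [neg_powere e s] is [+oo]: the right side is infinite if [m > 0], and both sides vanish if
   [m = 0]. *)
have [->|e_neq0] := eqVneq e 0.
  rewrite lgt0 {1}/neg_powere poweR0r ?gt_eqF// inve0 !mule0 adde0.
  have [->|m_neq0] := eqVneq m 0.
    by rewrite mul0e poweR0r ?gt_eqF// !mule0.
  by rewrite gt0_mulye ?lt0e ?m_neq0// gt0_muley ?lte_fin// leey.
rewrite lgt0; case: l lfin l0 lneq0 lgt0 => [l| |]// _ _ lneq0 lgt0.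
case: m mfin m0 => [m| |]// _ m0; case: e e0 eNy e_neq0 => [e| |]// e0 _ e_neq0.
rewrite !lte_fin !lee_fin in lgt0 m0 e0.
have {}e0 : (0 < e)%R by rewrite lt_neqAle eq_sym -eqe e_neq0.
rewrite /neg_powere !poweR_EFin !inver (gt_eqF lgt0) gt_eqF ?powR_gt0//.
rewrite -!EFinM -EFinD lee_fin.
rewrite -ler_pdivlMl// (le_trans (young_powR b01 sb q0 _ e0))//.
  by rewrite divr_ge0 ?(ltW lgt0).
rewrite le_eqVlt; apply/predU1P; left; field.
by rewrite (gt_eqF lgt0) gt_eqF ?powR_gt0.
Qed.

(** * Change of measure by the likelihood ratio, and conditioning *)

Section likelihood_ratio_theory.
Context d (T : measurableType d) (R : realType).
Variables (P0 P1 : probability T R) (F : filtration T).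
Hypothesis P1_dom : forall t, (0 < t)%N -> restr (F t) P1 `<< restr (F t) P0.

Local Notation L := (L P0 P1 F).

Lemma L_ge0 t w : 0 <= L t w.
Proof.
case: t => [|t]; first exact: lee01.
exact/Radon_Nikodym_SigmaFinite.f_ge0/P1_dom.
Qed.

Lemma L_fin_num t w : L t w \is a fin_num.
Proof.
case: t => [|t] //; exact/Radon_Nikodym_SigmaFinite.f_fin_num/P1_dom.
Qed.

Lemma measurable_L t : measurable_fun [set: subT (F t)] (L t : T -> \bar R).
Proof.
case: t => [|t]; first exact: measurable_cst.
apply: measurable_int (Radon_Nikodym_SigmaFinite.f_integrable _).
exact: P1_dom.
Qed.

Lemma L_density t (A : set T) : sub_sets (F t) A ->
  \int[P0]_(w in A) L t w = P1 A.
Proof.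
case: t => [|t] FA.
  rewrite integral_cst ?mul1e; last exact: sub_sets_measurable FA.
  (* Only the empty set and the whole space occur at time 0, and [P0] and [P1] agree on both. *)
  move: FA; rewrite filt_0 => -[] ->; rewrite ?measure0//.
  exact: etrans (probability_setT P0) (esym (probability_setT P1)).
have mA : measurable (A : set (subT (F t.+1))) by rewrite sub_measurableE.
rewrite -(integral_restr P0 (@measurable_L t.+1) (L_ge0 t.+1))//.
by rewrite -Radon_Nikodym_SigmaFinite.f_integral//; exact: P1_dom.
Qed.

Lemma integral_L t (f : T -> \bar R) (A : set T) :
  measurable_fun [set: subT (F t)] (f : T -> \bar R) -> (forall w, 0 <= f w) ->
  sub_sets (F t) A -> \int[P0]_(w in A) (f w * L t w) = \int[P1]_(w in A) f w.
Proof.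
move=> mf f0 FA; under [RHS]eq_integral do rewrite -[f _]mule1.
apply: (eq_integral_weight _ _ _ _ mf) => // [|w|B FB].
- exact: sub_measurable_fun (@measurable_L t).
- exact: L_ge0.
- rewrite L_density// integral_cst ?mul1e//; exact: sub_sets_measurable FB.
Qed.

End likelihood_ratio_theory.

(** Taking out what is known, in integrated form; the weight may take the value [+oo]. *)
Lemma integral_condexp_weight d (T : measurableType d) (R : realType)
    (P : probability T R) (G : Defs.sub_sigma_algebra T) (X f : T -> \bar R)
    (A : set T) :
  measurable_fun setT X -> (forall w, 0 <= X w) ->
  measurable_fun [set: subT G] (f : T -> \bar R) -> (forall w, 0 <= f w) ->
  sub_sets G A ->
  \int[P]_(w in A) (f w * condexp P G X w) = \int[P]_(w in A) (f w * X w).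
Proof.
move=> mX X0 mf f0; have [mY Y0 YX] := condexpP P G mX X0.
exact: (eq_integral_weight (sub_measurable_fun mY) _ _ _ mf).
Qed.

(** The endpoints fit as well: [Z = 0] gives [lne Z = -oo] and hence 0 on both sides, and [Z = +oo]
    gives [+oo]. *)
Lemma lambdaE d (T : measurableType d) (R : realType) (P0 P1 : probability T R)
    (F : filtration T) t (b : R) w : (0 < b)%R -> 0 <= Z P0 P1 F b t w ->
  expeR (- lambda P0 P1 F t b w) = Z P0 P1 F b t w `^ b^-1.
Proof.
move=> b0; rewrite /lambda oppeK.
case: (Z _ _ _ _ _ _) => [z| |]//= z0; last first.
  by rewrite gt0_muley ?lte_fin ?invr_gt0//= gt_eqF ?invr_gt0.
move: z0; rewrite lee_fin le_eqVlt => /predU1P[<-|z0].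
  by rewrite lexx gt0_muleNy ?lte_fin ?invr_gt0//= powR0// gt_eqF ?invr_gt0.
by rewrite leNgt z0/= /powR gt_eqF.
Qed.

(** * Conditional Hoelder inequality under [P1] *)

Theorem theorem4p9 (d : measure_display) (T : measurableType d) (R : realType)
    (P0 P1 : probability T R) (F : filtration T)
    (P1_dom : forall t, (0 < t)%N -> restr (F t) P1 `<< restr (F t) P0)
    (KL_fin : forall t, (0 < t)%N ->
      KL (restr (F t) P1) (restr (F t) P0) < +oo)
    (E : nat -> T -> \bar R) (E_bet : betting_sequence P0 F E)
    (n : nat) (n_gt0 : (0 < n)%N) (s : R) (s_gt0 : (0 < s)%R) :
  let beta := ((1 + s)^-1)%R in
  {ae P1, forall w,
    expeR (- lambda P0 P1 F n beta w) <=
      condexp P1 (F n.-1) (fun w' => neg_powere (E n w') s) w}.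
Proof.
move=> b; have [mE E0 E1] := E_bet n n_gt0.
have s1 : (0 < 1 + s)%R by lra.
have b0 : (0 < b)%R by rewrite invr_gt0.
have b01 : (0 < b < 1)%R by rewrite b0/= invf_lt1//; lra.
have b1 : (0 < 1 - b)%R by lra.
have sb : (s * b = 1 - b)%R by rewrite /b; field; lra.
set G := F n.-1; set Y := condexp P1 G _.
pose l := L P0 P1 F n.-1; pose m := L P0 P1 F n.
have l0 w : 0 <= l w := L_ge0 P1_dom n.-1 w.
have m0 w : 0 <= m w := L_ge0 P1_dom n w.
have Gl : measurable_fun [set: subT G] (l : T -> \bar R) by exact: measurable_L.
have Fm : measurable_fun [set: subT (F n)] (m : T -> \bar R).
  exact: measurable_L.
have ml := sub_measurable_fun Gl; have mm := sub_measurable_fun Fm.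
pose X w := Defs.ratio P0 P1 F n w `^ b.
have X0 w : 0 <= X w by exact: poweR_ge0.
have mX : measurable_fun setT X.
  apply: (measurableT_comp (measurable_poweR b)).
  apply: measurable_fun_ifT => //.
    exact: measurable_fun_lte.
  apply: emeasurable_funM => //.
  exact: measurableT_comp (@measurable_inve R) _.
pose W w := neg_powere (E n w) s.
have W0 w : 0 <= W w by exact: neg_powere_ge0.
have GW : measurable_fun [set: subT (F n)] (W : T -> \bar R).
  exact: measurableT_comp (measurable_neg_powere s) _.
have mW : measurable_fun setT W := sub_measurable_fun GW.
have mE' := sub_measurable_fun mE.
have [GZ Z0 ZX] := condexpP P0 G mX X0.
have [GV V0 VE] := condexpP P0 G mE' E0.
have [GY Y0 YW] := condexpP P1 G mW W0.
have key (q : R) A : (0 < q)%R -> sub_sets G A ->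
    \int[P1]_(w in A) Z P0 P1 F b n w <=
    (b * q `^ (b - 1))%:E * \int[P1]_(w in A) Y w +
    ((1 - b) * q `^ b)%:E * P1 A.
  move=> q0 GA; have mA := sub_sets_measurable GA.
  have FA : sub_sets (F n) A by exact: filt_nondecreasing (leq_pred n) _ GA.
  have c0 : 0 <= (b * q `^ (b - 1))%:E.
    by rewrite lee_fin mulr_ge0 ?powR_ge0 ?ltW.
  have c1 : 0 <= ((1 - b) * q `^ b)%:E.
    by rewrite lee_fin mulr_ge0 ?powR_ge0 ?ltW.
  have mlX : measurable_fun A (fun w => l w * X w).
    by apply: measurable_funTS; exact: emeasurable_funM.
  have mWm : measurable_fun A (fun w => W w * m w).
    by apply: measurable_funTS; exact: emeasurable_funM.
  have mlE : measurable_fun A (fun w => l w * E n w).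
    by apply: measurable_funTS; exact: emeasurable_funM.
  (* [Z] is [G]-measurable, so passing to [P0] costs the density [l]; as [l] is [G]-measurable too,
     [Z] can then be replaced by [X]. *)
  rewrite -(integral_L P1_dom GZ Z0 GA).
  under eq_integral do rewrite muleC.
  rewrite (integral_condexp_weight P0 mX X0 Gl l0 GA).
  apply: (@le_trans _ _ (\int[P0]_(w in A)
      ((b * q `^ (b - 1))%:E * (W w * m w) +
       ((1 - b) * q `^ b)%:E * (l w * E n w)))).
    apply: ge0_le_integral => //.
    - by move=> w _; exact: mule_ge0.
    - by apply: emeasurable_funD; exact: measurable_funeM.
    - move=> w _; apply: young_ratio => //; exact: L_fin_num.
  rewrite ge0_integralD//; last 4 first.
  - by move=> w _; rewrite !mule_ge0.
  - exact: measurable_funeM.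
  - by move=> w _; rewrite !mule_ge0.
  - exact: measurable_funeM.
  rewrite !ge0_integralZl//; last 2 first.
  - by move=> w _; rewrite mule_ge0.
  - by move=> w _; rewrite mule_ge0.
  (* The first term returns to [P1] through the density [m] on [F n], where [W] is measurable. *)
  rewrite (integral_L P1_dom GW W0 FA) YW// leeD// lee_wpmul2l//.
  (* The betting property bounds the conditional expectation of [E n] by 1 almost surely under [P0],
     leaving the integral of [l], which is [P1 A]. *)
  rewrite -(integral_condexp_weight P0 mE' E0 Gl l0 GA).
  rewrite -(L_density P1_dom GA); apply: ae_ge0_le_integral => //.
  - by move=> w _; exact: mule_ge0.
  - apply: measurable_funTS; apply: emeasurable_funM => //.
    exact: sub_measurable_fun GV.
  - exact: measurable_funTS.
  - by apply: filterS E1 => w V1 _; rewrite -[leRHS]mule1 lee_wpmul2l.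
have null (q r : R) : (0 < q)%R -> (q < r)%R ->
    {ae P1, forall w, Y w < q%:E -> Z P0 P1 F b n w <= (r `^ b)%:E}.
  move=> q0 qr.
  pose A := [set w | Y w < q%:E] `&` [set w | (r `^ b)%:E < Z P0 P1 F b n w].
  have qrb : (q `^ b < r `^ b)%R by apply: gt0_ltr_powR; rewrite ?nnegrE//; lra.
  have GA : sub_sets G A.
    have : measurable (A : set (subT G)).
      apply: measurableI.
        by rewrite -[X in measurable X]setTI; exact: measurable_lte.
      by rewrite -[X in measurable X]setTI; exact: measurable_lte.
    by rewrite sub_measurableE.
  have mA := sub_sets_measurable GA.
  have lower : (r `^ b)%:E * P1 A <= \int[P1]_(w in A) Z P0 P1 F b n w.
    rewrite -integral_cst//; apply: ge0_le_integral => //.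
    - by move=> w _; rewrite lee_fin powR_ge0.
    - exact: measurable_funTS (sub_measurable_fun GZ).
    - by move=> w [_ /ltW].
  have upper : \int[P1]_(w in A) Y w <= q%:E * P1 A.
    rewrite -integral_cst//; apply: ge0_le_integral => //.
    - exact: measurable_funTS (sub_measurable_fun GY).
    - by move=> w [/ltW].
  have c0 : 0 <= (b * q `^ (b - 1))%:E.
    by rewrite lee_fin mulr_ge0 ?powR_ge0 ?ltW.
  have := le_trans (le_trans lower (key q A q0 GA))
    (leeD (lee_wpmul2l c0 upper) (lexx _)).
  (* Finiteness of [P1 A] moves the inequality to the reals, where terms can be subtracted. *)
  have PA : P1 A \is a fin_num by exact: fin_num_measure.
  rewrite -(fineK PA) -!EFinM -EFinD lee_fin => PAle.
  (* With this the weights [b] and [1 - b] add up to the single bound [q^b P1(A)]. *)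
  have qE : (q `^ (b - 1) * q = q `^ b)%R.
    by rewrite -{2}(powRr1 (ltW q0)) -powRD ?subrK// (gt_eqF q0) implybT.
  have {PAle} : ((r `^ b - q `^ b) * fine (P1 A) <= 0)%R.
    by rewrite -qE in PAle *; nra.
  rewrite pmulr_rle0 ?subr_gt0// => PA0.
  exists A; split => //.
    by apply/eqP; rewrite eq_le measure_ge0 andbT -(fineK PA) lee_fin.
  by move=> w /= /not_implyP[Yq /negP]; rewrite -ltNge.
(* Pairs of rationals are enumerated by natural numbers to allow a countable intersection; a number
   coding no pair yields [(0, 0)], ruled out by [0 < q]. *)
pose u k : rat * rat := odflt (0%R, 0%R) (unpickle k).
have {}null k : {ae P1, forall w, (0 < ratr (u k).1 :> R)%R ->
    (ratr (u k).1 < ratr (u k).2 :> R)%R -> Y w < (ratr (u k).1)%:E ->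
    Z P0 P1 F b n w <= (ratr (u k).2 `^ b)%:E}.
  have [q0|q0] := ltP (0 : R)%R (ratr (u k).1); last exact: aeW.
  have [qr|qr] := ltP (ratr (u k).1 : R) (ratr (u k).2); last exact: aeW.
  by apply: filterS (null _ _ q0 qr) => w Hw _ _.
apply: filterS (ae_foralln null) => w Hw.
rewrite lambdaE ?[0 <= _]Z0// leNgt; apply/negP => YZ.
(* A real [v] stands in for [Z^(1/b)], which may be [+oo]; in that case [y + 1] serves. *)
have [y [v [Yy yv vZ]]] : exists y v : R, [/\ Y w = y%:E, (y < v)%R &
    v%:E <= Z P0 P1 F b n w `^ b^-1].
  have Yfin : Y w \is a fin_num.
    by rewrite ge0_fin_numE//; apply: lt_le_trans YZ (leey _).
  move: YZ (poweR_ge0 (Z P0 P1 F b n w) b^-1).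
  rewrite -(fineK Yfin); case: (_ `^ _) => [v| |//].
    by rewrite lte_fin => yv _; exists (fine (Y w)), v.
  by move=> _ _; exists (fine (Y w)), (fine (Y w) + 1)%R; rewrite leey ltrDl.
have y0 : (0 <= y)%R by rewrite -lee_fin -Yy.
(* Choosing rationals on either side of the midpoint gives [y < q < r < v]. *)
have [q /[!in_itv]/= /andP[yq qm]] := rat_in_itvoo (midf_lt yv).1.
have [r /[!in_itv]/= /andP[mr rv]] := rat_in_itvoo (midf_lt yv).2.
have := Hw (pickle (q, r)); rewrite /u pickleK/= Yy lte_fin => /(_ _ _ yq) Zr.
have {}Zr : Z P0 P1 F b n w <= (ratr r `^ b)%:E by apply: Zr; lra.
have r0 : (0 <= ratr r :> R)%R by lra.
(* The bound [Z <= r^b] yields [v <= r], against [r < v]. *)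
have : v%:E <= ((ratr r `^ b)%:E) `^ b^-1.
  apply: le_trans vZ _; apply: gt0_ler_poweR Zr; first by rewrite invr_ge0 ltW.
  - by rewrite in_itv/= leey andbT; exact: Z0.
  - by rewrite in_itv/= leey andbT lee_fin powR_ge0.
rewrite poweR_EFin -powRrM mulfV ?gt_eqF// powRr1// lee_fin; lra.
Qed.
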